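(* Let $G$ be a bipartite graph with bipartition $A\cup B$, whose vertices carry nonnegative weights $w$ with total weights $w(A)=w(B)=1$, and let $w(G)=\sum_{a\sim b}w(a)w(b)$, the sum over edges $ab$ with $a\in A$, $b\in B$. Let $t$ be a positive integer, and assume that every set of $t$ vertices in $A$ has common neighbourhood with total weight at most $q$, and that every vertex in $A$ has weight at most $\rho$. Then $$w(G)\le q^{1/t}+t\rho.$$ *)

(* Defs.v *)
From mathcomp Require Import all_boot all_order all_algebra.
From mathcomp Require Import reals exp.
Set Implicit Arguments.
Unset Strict Implicit.
Unset Printing Implicit Defensive.
Import Order.TTheory GRing.Theory Num.Theory.
Local Open Scope ring_scope.

Definition simple_graph (V : finType) (e : rel V) : Prop :=
  symmetric e /\ irreflexive e.

Definition bipartition (V : finType) (e : rel V) (A B : {set V}) : Prop :=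
  [/\ A :|: B = [set: V],
      [disjoint A & B] &
      forall x y : V, e x y ->
        (x \in A) && (y \in B) || (x \in B) && (y \in A)].

Definition common_nbhd (V : finType) (e : rel V) (S : {set V}) : {set V} :=
  [set v | [forall x in S, e x v]].

Definition set_weight (R : realType) (V : finType) (w : V -> R)
    (S : {set V}) : R :=
  \sum_(v in S) w v.

(* Summing over ordered pairs (a, b) in A x B counts each edge of a bipartite
   graph with parts A and B exactly once. *)
Definition edge_weight (R : realType) (V : finType) (e : rel V)
    (A B : {set V}) (w : V -> R) : R :=
  \sum_(a in A) \sum_(b in B | e a b) w a * w b.

(* Main.v *)
(** For [b] in [B] let [d b] be the total weight of its neighbours in [A], so
    that [w(G)] is the [w]-average of [d] over [B].  Choosing [t] distinct
    neighbours of [b] one after the other, at most [t * rho] of [d b] is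
    excluded at each step, so the [t]-tuples of distinct neighbours of [b]
    have total weight at least [max(0, d b - t * rho) ^ t].  Summing over [b]
    and exchanging the sums, the average of these powers is at most [q], since
    every [t]-set has common neighbourhood of weight at most [q].  Jensen's
    inequality for [x ^ t] concludes. *)
Require Import Defs.
From mathcomp Require Import all_boot all_order all_algebra.
From mathcomp Require Import reals exp.
From mathcomp Require Import ring lra.
Set Implicit Arguments.
Unset Strict Implicit.
Unset Printing Implicit Defensive.
Import Order.TTheory GRing.Theory Num.Theory.
Local Open Scope ring_scope.

(** The graph of [x ^+ n.+1] lies above its tangent at [m], rearranged to avoid subtraction.
    Induction: multiply the bound for [n] by [x] and add [0 <= n.+1%:R * m ^+ n * (x - m) ^+ 2],
    with [n] the old exponent. *)
Lemma exprn_tangent (R : realDomainType) (n : nat) (m x : R) :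
  0 <= m -> 0 <= x ->
  n.+1%:R * m ^+ n * x <= x ^+ n.+1 + n%:R * m ^+ n.+1.
Proof.
move=> m0 x0; elim: n => [|n IHn]; first by rewrite !expr0 !expr1; lra.
have : 0 <= n.+1%:R * m ^+ n * (x - m) ^+ 2.
  by apply: mulr_ge0; rewrite ?sqr_ge0 ?mulr_ge0 ?exprn_ge0.
have := ler_wpM2r x0 IHn.
rewrite !exprS -[n.+2]addn1 -[n.+1]addn1 !natrD.
set M := m ^+ n; set X := x ^+ n; set N : R := n%:R => h1 h2.
have -> : (N + 1%:R + 1%:R) * (m * M) * x =
  (N + 1%:R) * M * x * x - N * (m * M) * x + (N + 1%:R) * (m * (m * M))
  - (N + 1%:R) * M * (x - m) ^+ 2 by ring.
have e3 : (x * X + N * (m * M)) * x = x * (x * X) + N * (m * M) * x by ring.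
by lra.
Qed.

(** Average the tangent inequality at the mean [m]; its left side becomes [n.+1%:R * m ^+ n.+1], and
    [n%:R * m ^+ n.+1] cancels. *)
Lemma jensen_exprn (R : realDomainType) (I : finType) (P : pred I)
    (w p : I -> R) (n : nat) :
  (forall i, 0 <= w i) -> (forall i, 0 <= p i) -> \sum_(i | P i) w i = 1 ->
  (\sum_(i | P i) w i * p i) ^+ n.+1 <= \sum_(i | P i) w i * p i ^+ n.+1.
Proof.
move=> w0 p0 w1; set m := \sum_(i | P i) w i * p i.
have m0 : 0 <= m by apply: sumr_ge0 => i _; rewrite mulr_ge0.
have : \sum_(i | P i) w i * (n.+1%:R * m ^+ n * p i) <=
       \sum_(i | P i) w i * (p i ^+ n.+1 + n%:R * m ^+ n.+1).
  by apply: ler_sum => i _; rewrite ler_wpM2l ?exprn_tangent.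
under eq_bigr => i _ do rewrite mulrCA.
rewrite -mulr_sumr -/m.
under [X in _ <= X]eq_bigr => i _ do rewrite mulrDr.
rewrite big_split /= -mulr_suml w1 mul1r -mulrA -exprSr -natr1 mulrDl mul1r.
by lra.
Qed.

Section WeightedBipartite.
Variables (R : realType) (V : finType) (e : rel V) (A B : {set V}) (w : V -> R).
Hypothesis w_ge0 : forall v, 0 <= w v.

Lemma set_weight_ge0 (S : {set V}) : 0 <= set_weight w S.
Proof. exact: sumr_ge0. Qed.

Lemma set_weight_le_card (S : {set V}) (rho : R) :
  (forall a, a \in S -> w a <= rho) -> set_weight w S <= #|S|%:R * rho.
Proof.
move=> hS; apply: le_trans (ler_sum _ hS) _.
by rewrite sumr_const mulr_natl.
Qed.

Lemma edge_weight_degrees :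
  edge_weight e A B w = \sum_(b in B) w b * \sum_(a in A | e a b) w a.
Proof.
rewrite /edge_weight.
under eq_bigr => a _ do rewrite big_mkcondr.
rewrite exchange_big; apply: eq_bigr => b _ /=.
rewrite -big_mkcondr mulr_sumr.
by apply: eq_bigr => a _; rewrite mulrC.
Qed.

(** This serves the degenerate case where [A] has fewer than [t] vertices. *)
Lemma edge_weight_le1 :
  set_weight w A = 1 -> set_weight w B = 1 -> edge_weight e A B w <= 1.
Proof.
move=> wA wB; rewrite edge_weight_degrees -[leRHS]wB /set_weight.
apply: ler_sum => b _; rewrite -[leRHS]mulr1 ler_wpM2l // -wA /set_weight.
by rewrite big_mkcondr; apply: ler_sum => a _; case: ifP.
Qed.

Variables (t : nat) (q rho : R).
Hypotheses (q_ge0 : 0 <= q) (rho_ge0 : 0 <= rho) (wA1 : set_weight w A <= 1).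
Hypothesis w_le_rho : forall a, a \in A -> w a <= rho.
Hypothesis common_nbhd_le : forall S : {set V}, S \subset A -> #|S| = t ->
  set_weight w (common_nbhd e S) <= q.

(** Truncation at 0 keeps the powers nonnegative and makes Jensen applicable. *)
Let excess (b : V) : R :=
  Num.max 0 (\sum_(a in A | e a b) w a - t%:R * rho).

Lemma excess_ge0 b : 0 <= excess b.
Proof. by rewrite le_max lexx. Qed.

(** Removing [S] costs at most [t%:R * rho], whatever its size up to [t], so one and the same
    [excess b] serves at every stage of the choice. *)
Lemma excess_le (S : {set V}) b : S \subset A -> (#|S| <= t)%N ->
  excess b <= \sum_(a in A :\: S | e a b) w a.
Proof.
move=> SA St; rewrite ge_max sumr_ge0 //= lerBlDr.
have wS : set_weight w S <= t%:R * rho.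
  apply: le_trans (set_weight_le_card _) _.
    by move=> a aS; apply: w_le_rho; apply: (subsetP SA).
  by rewrite ler_wpM2r // ler_nat.
apply: le_trans (lerD (lexx _) wS); rewrite /set_weight big_mkcond
  [X in _ <= X + _]big_mkcond [X in _ <= _ + X]big_mkcond.
rewrite -big_split; apply: ler_sum => a _ /=; rewrite !inE.
have := w_ge0 a.
by case: (a \in S) (a \in A) (e a b) => [] [] [] /=; lra.
Qed.

Lemma common_nbhdU1 (S : {set V}) a b :
  (b \in common_nbhd e (a |: S)) = e a b && (b \in common_nbhd e S).
Proof.
rewrite !inE; apply/forall_inP/andP => [h|[eab /forall_inP h] x].
  split; first by apply: h; rewrite setU11.
  by apply/forall_inP => x xS; apply: h; rewrite setU1r.
by rewrite in_setU1 => /predU1P[->|/h].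
Qed.

(** Here [S] holds the vertices chosen so far and [k] choices remain. One factor [excess b] is
    traded for the weight of a next neighbour [a] outside [S]. After exchanging sums, induction
    bounds the inner sum for [a |: S] by [q], and the outer weights [w a] add up to at most 1. *)
Lemma sum_excess_common_nbhd_le k (S : {set V}) :
  S \subset A -> (#|S| + k)%N = t ->
  \sum_(b in B | b \in common_nbhd e S) w b * excess b ^+ k <= q.
Proof.
elim: k S => [|k IHk] S SA St.
  apply: le_trans (common_nbhd_le SA _); last by rewrite -St addn0.
  rewrite /set_weight big_mkcond [leRHS]big_mkcond; apply: ler_sum => b _ /=.
  by rewrite expr0 mulr1; have := w_ge0 b; case: (b \in B); case: ifP.
apply: (@le_trans _ _ (\sum_(b in B | b \in common_nbhd e S)
    \sum_(a in A :\: S | e a b) w a * (w b * excess b ^+ k))).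
  apply: ler_sum => b _; rewrite -mulr_suml exprS mulrCA ler_wpM2r //.
    by rewrite mulr_ge0 ?exprn_ge0 ?excess_ge0.
  by apply: excess_le; rewrite // -St leq_addr.
under eq_bigr => b _ do rewrite big_mkcondr.
rewrite exchange_big /=.
apply: (@le_trans _ _ (\sum_(a in A :\: S) w a * q)).
  apply: ler_sum => a; rewrite inE => /andP[aS aA].
  rewrite -big_mkcondr -mulr_sumr ler_wpM2l //.
  rewrite (eq_bigl (fun b => (b \in B) && (b \in common_nbhd e (a |: S)))).
    apply: IHk; first by rewrite subUset sub1set aA.
    by rewrite cardsU1 aS -St addnS.
  by move=> b; rewrite common_nbhdU1 /= -andbA [e a b && _]andbC.
rewrite -mulr_suml -[leRHS]mul1r ler_wpM2r //; apply: le_trans wA1.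
rewrite /set_weight [leRHS](big_setID S) lerDr.
exact: sumr_ge0.
Qed.

Lemma edge_weight_le_powR : (0 < t)%N -> set_weight w B = 1 ->
  edge_weight e A B w <= q `^ t%:R^-1 + t%:R * rho.
Proof.
move=> t_gt0 wB1; set m := \sum_(b in B) w b * excess b.
have m_ge0 : 0 <= m by apply: sumr_ge0 => b _; rewrite mulr_ge0 ?excess_ge0.
have mt : m ^+ t <= q.
  have := @sum_excess_common_nbhd_le t set0 (sub0set _).
  rewrite cards0 => /(_ erefl); apply: le_trans.
  (* Every vertex is in the common neighbourhood of the empty set. *)
  rewrite (eq_bigl (fun b => b \in B)) => [|b]; last first.
    apply: andb_idr => _; rewrite inE.
    by apply/forall_inP => x; rewrite inE.
  by rewrite -(prednK t_gt0) jensen_exprn // => b; exact: excess_ge0.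
apply: (@le_trans _ _ (m + t%:R * rho)).
  have -> : t%:R * rho = \sum_(b in B) w b * (t%:R * rho).
    by rewrite -mulr_suml -/(set_weight w B) wB1 mul1r.
  rewrite edge_weight_degrees -big_split; apply: ler_sum => b _ /=.
  by rewrite -mulrDr ler_wpM2l // -lerBlDr le_max lexx orbT.
rewrite lerD2r.
have -> : m = (m ^+ t) `^ t%:R^-1.
  by rewrite -powR_mulrn // -powRrM divff ?powRr1 // pnatr_eq0 -lt0n.
by apply: ge0_ler_powR; rewrite ?invr_ge0 ?ler0n ?nnegrE ?exprn_ge0.
Qed.

End WeightedBipartite.

Theorem theorem3p1 (R : realType) (V : finType) (e : rel V) (A B : {set V})
    (w : V -> R) (t : nat) (q rho : R)
    (hG : simple_graph e)
    (hAB : bipartition e A B)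
    (hw : forall v : V, 0 <= w v)
    (hwA : set_weight w A = 1)
    (hwB : set_weight w B = 1)
    (ht : (0 < t)%N)
    (hq : forall S : {set V}, S \subset A -> #|S| = t ->
            set_weight w (common_nbhd e S) <= q)
    (hrho : forall a : V, a \in A -> w a <= rho) :
  edge_weight e A B w <= q `^ (t%:R^-1) + t%:R * rho.
Proof.
have rho_ge0 : 0 <= rho.
  have [A0|[a aA]] := set_0Vmem A; last exact: le_trans (hrho a aA).
  by move: hwA; rewrite A0 /set_weight big_set0 => /esym/eqP; rewrite oner_eq0.
(* The sign of [q] is known only once some [t]-subset of [A] exists: [q] then bounds a nonnegative
   weight. *)
have [tA|At] := leqP t #|A|.
  have [S SA St] : exists2 S : {set V}, S \subset A & #|S| = t.
    have : (0 < #|[set S : {set V} | S \subset A & #|S| == t]|)%N.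
      by rewrite cards_draws bin_gt0.
    by case/card_gt0P => S; rewrite inE => /andP[SA /eqP St]; exists S.
  apply: edge_weight_le_powR => //; last by rewrite hwA.
  exact: le_trans (set_weight_ge0 hw _) (hq S SA St).
(* There are no [t]-subsets of [A], so [q] is arbitrary, but [1 <= t * rho]. *)
apply: le_trans (edge_weight_le1 e hw hwA hwB) _.
(* The real power is nonnegative even for negative [q]. *)
rewrite -[leLHS]add0r lerD ?powR_ge0 //.
have := set_weight_le_card hrho; rewrite hwA => /le_trans; apply.
by rewrite ler_wpM2r // ler_nat ltnW.
Qed.
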